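(* There is a universal constant $c>0$ such that, for $n\ge2$, $\varepsilon\in(0,1)$, $\delta\in(0,1)$, there is no $\delta$-correct stopping rule $T$ for testing $\mathcal{D}=U_n$ versus $\mathrm{TV}(\mathcal{D},U_n)>\varepsilon$ such that both $$\mathbb{P}\left(\tau_2(T,\mathcal{D})\le c\frac{\sqrt{n\log(1/(3\delta))}}{\mathrm{TV}(\mathcal{D},U_n)^2}\right)\ge1-\delta\ \text{ for every }\mathcal{D}\text{ with }\mathrm{TV}(\mathcal{D},U_n)>\varepsilon,$$ and $$\mathbb{P}\left(\tau_1(T,U_n)\le c\frac{\sqrt{n\log(1/(3\delta))}}{\varepsilon^2}\right)\ge1-\delta.$$ The same holds with $\sqrt{n\log(1/(3\delta))}$ replaced by $\log(1/(3\delta))$.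
   Context: $[n]=\{1,\dots,n\}$, $U_n$ uniform, $\mathrm{TV}(\mathcal{D},\mathcal{D}')=\frac12\sum_i|\mathcal{D}_i-\mathcal{D}'_i|$. A stopping rule is a function $T:[n]^*\to\{0,1,2\}$ with $T(x)\ne0\Rightarrow T(xy)=T(x)$ for all strings $x,y$; with $x_1,x_2,\dots$ i.i.d. from $\mathcal{D}$, $\tau_j(T,\mathcal{D})=\inf\{t:T(x_1\cdots x_t)=j\}$, $j=1,2$. $T$ is $\delta$-correct if $\mathbb{P}(\tau_2(T,U_n)\le\tau_1(T,U_n))\le\delta$ and $\mathbb{P}(\tau_1(T,\mathcal{D})\le\tau_2(T,\mathcal{D}))\le\delta$ whenever $\mathrm{TV}(\mathcal{D},U_n)>\varepsilon$.
   Formalization: The claim fails for ε near 1, or if no D has TV(D,U_n)>ε. Proved instead: for each ε₀<1 there is c>0, depending only on ε₀, that works for all n≥2, δ∈(0,1) and ε∈(0,ε₀] for which some D has TV(D,U_n)>ε. *)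

(* Defs.v *)
From HB Require Import structures.
From mathcomp Require Import all_boot all_order all_algebra.
From mathcomp Require Import all_classical all_reals all_analysis.

Set Implicit Arguments.
Unset Strict Implicit.
Unset Printing Implicit Defensive.

Import Order.TTheory GRing.Theory Num.Theory.
Import numFieldNormedType.Exports.

Local Open Scope classical_set_scope.
Local Open Scope ring_scope.

(* The set [n] = {1, ..., n} is encoded as 'I_n.

   Boundary of the range of delta: for delta >= 1/3 the number
   ln (1 / (3 * delta)) is nonpositive, and Num.sqrt of a nonpositive number
   is 0.

   Range of eps: the lower bound needs a distribution D with TV(D, U_n) > eps,
   that is, eps < 1 - 1/n; otherwise, for delta <= 1/3, the rule that always
   answers 1 meets every requirement. It also needs eps bounded away from 1:
   for eps just below 1 - 1/n every such D is close to a point mass, and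
   comparing two samples already suffices when n is large. The constant
   therefore depends on an upper bound eps0 < 1 for eps, and on nothing else. *)

Record dist (R : realType) (n : nat) := Dist {
  mass :> 'I_n -> R;
  mass_ge0 : forall i, 0 <= mass i;
  mass_sum1 : \sum_(i < n) mass i = 1 }.

Lemma uniform_mass_ge0 (R : realType) (n : nat) (i : 'I_n) :
  0 <= (n%:R : R)^-1.
Proof. by rewrite invr_ge0 ler0n. Qed.

Lemma uniform_mass_sum1 (R : realType) (n : nat) :
  (0 < n)%N -> \sum_(i < n) (n%:R : R)^-1 = 1.
Proof.
move=> n_gt0; rewrite sumr_const card_ord -[LHS]mulr_natr mulVf//.
by rewrite pnatr_eq0 -lt0n.
Qed.

Definition unif (R : realType) (n : nat) (n_gt0 : (0 < n)%N) : dist R n :=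
  Dist (@uniform_mass_ge0 R n) (uniform_mass_sum1 R n_gt0).

Definition TV (R : realType) (n : nat) (D D' : dist R n) : R :=
  2^-1 * \sum_(i < n) `|D i - D' i|.

Record stopping_rule (n : nat) := StoppingRule {
  verdict :> seq 'I_n -> 'I_3;
  verdict_stable : forall x y : seq 'I_n,
    nat_of_ord (verdict x) <> 0%N -> verdict (x ++ y) = verdict x }.

(* A probability space carrying an i.i.d. sequence with common law D. Every
   probability computed from a stopping rule depends only on D, not on the
   space that is chosen. *)
Record iid_sample (R : realType) (n : nat) (D : dist R n) := IidSample {
  sample_display : measure_display;
  sample_space : measurableType sample_display;
  sample_prob : probability sample_space R;
  obs : nat -> sample_space -> 'I_n;
  obs_measurable : forall t i, measurable (obs t @^-1` [set i]);
  obs_law : forall t i, sample_prob (obs t @^-1` [set i]) = (D i)%:E;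
  obs_independent : forall (J : seq nat) (A : nat -> set 'I_n), uniq J ->
    sample_prob (\bigcap_(t in [set` J]) (obs t @^-1` A t)) =
    (\prod_(t <- J) sample_prob (obs t @^-1` A t))%E }.

Arguments obs {R n D} _ t w.
Arguments sample_prob {R n D} _.

(* tau T j x = inf {t >= 0 : T (x_1 ... x_t) = j}, where the observations
   x_1, x_2, ... are x 0, x 1, ...; it is +oo if there is no such t. *)
Definition tau (R : realType) (n : nat) (T : stopping_rule n) (j : nat)
    (x : nat -> 'I_n) : \bar R :=
  ereal_inf [set (t%:R : R)%:E | t in [set t | T (mkseq x t) = j :> nat]].

Definition Prob (R : realType) (n : nat) (D : dist R n) (S : iid_sample D)
    (E : (nat -> 'I_n) -> Prop) : \bar R :=
  sample_prob S [set w | E (fun t => obs S t w)].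

Definition delta_correct (R : realType) (n : nat) (n_gt0 : (0 < n)%N)
    (S : forall D : dist R n, iid_sample D) (eps delta : R)
    (T : stopping_rule n) : Prop :=
  (Prob (S (unif R n_gt0)) (fun x => (tau R T 2 x <= tau R T 1 x)%E)
     <= delta%:E)%E /\
  forall D : dist R n, eps < TV D (unif R n_gt0) ->
    (Prob (S D) (fun x => (tau R T 1 x <= tau R T 2 x)%E) <= delta%:E)%E.

Definition stops_within (R : realType) (n : nat) (n_gt0 : (0 < n)%N)
    (S : forall D : dist R n, iid_sample D) (eps delta : R)
    (T : stopping_rule n) (b : R) : Prop :=
  (forall D : dist R n, eps < TV D (unif R n_gt0) ->
    ((1 - delta)%:E <= Prob (S D) (fun x =>
       (tau R T 2 x <= (b / TV D (unif R n_gt0) ^+ 2)%:E)%E))%E) /\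
  ((1 - delta)%:E <= Prob (S (unif R n_gt0)) (fun x =>
     (tau R T 1 x <= (b / eps ^+ 2)%:E)%E))%E.

(* Main.v *)
(* Verdicts are stable, so at most one of tau_1, tau_2 is finite. Let B be the
   event that the verdict after m samples is 2, where m >= b / TV(D, U_n)^2 is
   fixed. Then B has probability at most delta under U_n and at least 1 - delta
   under every alternative D, hence under any mixture of alternatives. Split
   the n points into k blocks of size at most G, where G depends only on eps0
   and 1 - k/n > eps, and let D_r move the whole uniform mass of each block to
   one point r of that block, so that TV(D_r, U_n) >= 1 - k/n >= 1/2. For r
   uniform, Cauchy-Schwarz gives
     (1 - delta)^2 <= delta * E_{r,r'} (n sum_i D_r(i) D_r'(i))^m.
   The right-hand expectation is at most G^m, whence log(1/(3 delta)) <= G m.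
   It is also at most exp(3 G^4 m^2 / n), because m (n sum_i D_r(i) D_r'(i) - 1)
   is a sum of k independent centred variables bounded by m G^2 / n, whence
   n log(1/(3 delta)) <= 3 G^4 m^2. For delta >= 1/3 the budget b is
   nonpositive, and the empty word would need both verdicts. *)

Require Import Defs.
From mathcomp Require Import all_boot all_order all_algebra.
From mathcomp Require Import all_classical all_reals all_analysis.
From mathcomp Require Import ring lra zify.

Set Implicit Arguments.
Unset Strict Implicit.
Unset Printing Implicit Defensive.

Import Order.TTheory GRing.Theory Num.Theory.

Local Open Scope ring_scope.

(** * Laws of finite words of observations *)

Section Sampling.
Context {R : realType} {n : nat} {D : dist R n} (S : iid_sample D).

Let traj (w : sample_space S) : nat -> 'I_n := fun t => obs S t w.

(** The default of [nth] is the observed letter itself, so no fixed element of ['I_n] is needed and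
    each condition is a preimage under a single [obs S t], as [obs_independent] requires. *)
Let cylinder m (v : m.-tuple 'I_n) : set (sample_space S) :=
  (\bigcap_(t in [set` iota 0 m]) (obs S t @^-1` [set i | nth i v t = i]))%classic.

Let cylinderE m (v : m.-tuple 'I_n) :
  cylinder v = [set w | mkseq (traj w) m = v]%classic.
Proof.
apply/seteqP; split => w /= vw.
  apply: (@eq_from_nth _ (traj w 0)); first by rewrite size_mkseq size_tuple.
  move=> t; rewrite size_mkseq => tm; rewrite nth_mkseq //.
  have := vw t; rewrite /= mem_iota add0n tm => /(_ isT) vt.
  by rewrite -[LHS]vt; apply: set_nth_default; rewrite size_tuple.
by move=> t; rewrite /= mem_iota add0n -vw => /= tm; rewrite nth_mkseq.
Qed.

Let measurable_obs t (A : set 'I_n) : measurable (obs S t @^-1` A)%classic.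
Proof.
rewrite (_ : (obs S t @^-1` A = \bigcup_(i in A) (obs S t @^-1` [set i]))%classic).
  apply: fin_bigcup_measurable => [|i _]; last exact: obs_measurable.
  exact: finite_finset.
by apply/seteqP; split => [w Aw|w [i Ai /= ->]//]; exists (obs S t w).
Qed.

Let measurable_cylinder m (v : m.-tuple 'I_n) : measurable (cylinder v).
Proof. by apply: bigcap_measurableType => t _; exact: measurable_obs. Qed.

Let Prob_cylinder m (v : m.-tuple 'I_n) :
  sample_prob S (cylinder v) = (\prod_(s < m) D (tnth v s))%:E.
Proof.
rewrite obs_independent ?iota_uniq //.
have -> : iota 0 m = index_iota 0 m by rewrite /index_iota subn0.
rewrite big_mkord -prodEFin.
apply: eq_bigr => s _; rewrite -(obs_law S s); congr (sample_prob S _).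
apply/seteqP; split => w /=; rewrite (tnth_nth (obs S s w)) //.
Qed.

Let word_cylinders m (B : pred (seq 'I_n)) :
  [set w | B (mkseq (traj w) m)]%classic =
  (\bigcup_(v in [set` seq.filter (fun v : m.-tuple 'I_n => B v)
      (enum {: m.-tuple 'I_n})]) cylinder v)%classic.
Proof.
apply/seteqP; split => [w /= Bw|w [v /=]]; rewrite ?mem_filter ?cylinderE /=.
  have sz : size (mkseq (traj w) m) == m by rewrite size_mkseq.
  by exists (Tuple sz); rewrite ?cylinderE //= mem_filter mem_enum Bw.
by case/andP => Bv _ ->.
Qed.

Lemma measurable_word m (B : pred (seq 'I_n)) :
  measurable [set w | B (mkseq (fun t => obs S t w) m)]%classic.
Proof.
rewrite word_cylinders; apply: fin_bigcup_measurable => // v _.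
Qed.

(** Additivity over the disjoint cylinders removes the sample space: from here on, events about [m]
    observations are finite sums over words. *)
Lemma Prob_word m (B : pred (seq 'I_n)) :
  Prob S (fun x => B (mkseq x m)) =
  (\sum_(v : m.-tuple 'I_n | B v) \prod_(s < m) D (tnth v s))%:E.
Proof.
rewrite /Prob word_cylinders measure_fin_bigcup //; last first.
  by move=> u v _ _ [w []]; rewrite !cylinderE /= => -> /val_inj.
rewrite -fsbig_seq; last exact/filter_uniq/enum_uniq.
rewrite big_filter big_enum_cond /= -sumEFin.
by apply: eq_bigr => v _; exact: Prob_cylinder.
Qed.

End Sampling.

(** * Stopping times expressed through verdicts *)

Section StoppingTimes.
Context {R : realType} {n : nat} (T : stopping_rule n).
Implicit Types (x : nat -> 'I_n) (j t m : nat).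

Lemma verdict_mono x j t m : (t <= m)%N -> (j != 0)%N ->
  T (mkseq x t) = j :> nat -> T (mkseq x m) = j :> nat.
Proof.
move=> tm j0 Tt; rewrite -(subnKC tm) /mkseq iotaD map_cat verdict_stable //.
by rewrite Tt; apply/eqP.
Qed.

(** Stability carries a verdict from any earlier time up to the integer part of [b]. The condition
    [0 <= b] is kept because [Num.truncn] sends negative numbers to 0. *)
Lemma tau_leP j x (b : R) : (j != 0)%N ->
  (tau R T j x <= b%:E)%E =
  (0 <= b) && (T (mkseq x (Num.truncn b)) == j :> nat).
Proof.
move=> j0; apply/idP/andP => [le_b|[b0 /eqP Tb]].
  (* The strict bound by the next integer yields an actual time [t] from the infimum, and
     integrality then gives [t <= Num.truncn b]. *)
  have /ereal_inf_lt [_ [t /= Tt <-]] :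
      (tau R T j x < (Num.truncn b).+1%:R%:E)%E.
    by apply: le_lt_trans le_b _; rewrite lte_fin truncnS_gt.
  rewrite lte_fin ltr_nat ltnS => tb.
  have b0 : 0 <= b.
    rewrite -lee_fin; apply: le_trans le_b.
    by apply: le_ereal_inf_tmp => _ [s _ <-]; rewrite lee_fin.
  by rewrite b0; split=> //; apply/eqP/(verdict_mono tb).
apply: ge_ereal_inf; exists (Num.truncn b)%:R%:E.
  by exists (Num.truncn b).
by rewrite lee_fin truncn_le.
Qed.

(** A verdict 1 at time [t] would force verdict 2 at the same [t]. Without any verdict 1, [tau_1] is
    infinite and the comparison holds, ties at infinity included. *)
Lemma tau21P x :
  (tau R T 2 x <= tau R T 1 x)%E <-> forall t, T (mkseq x t) <> 1%N :> nat.
Proof.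
split=> [le21 t T1|T1].
  have : (tau R T 2 x <= t%:R%:E)%E.
    by apply: le_trans le21 _; apply: ereal_inf_lbound; exists t.
  by rewrite tau_leP // ler0n natrK T1.
suff -> : tau R T 1 x = +oo%E by rewrite leey.
by apply/ereal_inf_pinfty => y [t /= Tt _]; case: (T1 t).
Qed.

End StoppingTimes.

(** * Elementary inequalities and bounds on total variation *)

Lemma expR_le_add_expR_sqr (R : realType) (y : R) : expR y <= y + expR (3 * y ^+ 2).
Proof.
have [y_le|y_gt] := leP y (1 / 3); last first.
  have: expR y <= expR (3 * y ^+ 2) by rewrite ler_expR; nra.
  by lra.
have half_ge : 1 - y / 2 <= expR (- (y / 2)) by exact: expR_ge1Dx.
have sqr_ge : (1 - y / 2) ^+ 2 <= expR (- y).
  rewrite (_ : - y = 2%:R * - (y / 2)); last by lra.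
  by rewrite expRM_natl; rewrite ler_sqr // nnegrE; nra.
have expN : expR y * expR (- y) = 1 by rewrite expRxMexpNx_1.
have y_sqr := expR_ge1Dx (3 * y ^+ 2).
have sqr_y := sqr_ge0 y.
(* For [y <= 1 / 3] this follows by multiplying with [(1 - y / 2) ^+ 2 <= expR (- y)]: the right
   side becomes 1 plus a nonnegative remainder. *)
suff main : expR y <= 1 + y + y ^+ 2.
  apply: (le_trans main); rewrite addrAC [leRHS]addrC lerD2r.
  by apply: le_trans y_sqr; lra.
have sqr_gt0 : 0 < (1 - y / 2) ^+ 2 by apply: exprn_gt0; lra.
rewrite -(ler_pM2r sqr_gt0).
have : expR y * (1 - y / 2) ^+ 2 <= 1.
  by rewrite -[leRHS]expN ler_wpM2l // expR_ge0.
move=> /le_trans; apply.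
rewrite [leRHS](_ : _ = 1 + y ^+ 2 / 4 * (1 - 3 * y + y ^+ 2)); last by field.
have : 0 <= y ^+ 2 / 4 * (1 - 3 * y + y ^+ 2) by apply: mulr_ge0; nra.
by lra.
Qed.

Lemma sqr_sum_le_card (R : realFieldType) (I : finType) (B : {pred I}) (F : I -> R) :
  (\sum_(i in B) F i) ^+ 2 <= #|B|%:R * \sum_(i in B) F i ^+ 2.
Proof.
set A := \sum_(i in B) F i; set Q := \sum_(i in B) F i ^+ 2; set k : R := #|B|%:R.
have [B0|B0] := eqVneq #|B| 0%N.
  rewrite /A (eq_bigl pred0) ?big_pred0_eq ?expr0n ?mulr_ge0 ?sumr_ge0 //.
    by move=> i _; exact: sqr_ge0.
  exact/card0_eq.
have k_gt0 : 0 < k by rewrite ltr0n lt0n.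
suff : 0 <= k * (k * Q - A ^+ 2) by rewrite pmulr_rge0 // subr_ge0.
have -> : k * (k * Q - A ^+ 2) = \sum_(i in B) (k * F i - A) ^+ 2.
  transitivity (\sum_(i in B) (k ^+ 2 * F i ^+ 2 - 2 * k * A * F i + A ^+ 2)).
    rewrite !big_split /= sumrN -!mulr_sumr sumr_const -/A -/Q -mulr_natr -/k.
    by ring.
  by apply: eq_bigr => i _; ring.
by apply: sumr_ge0 => i _; exact: sqr_ge0.
Qed.

(** The mass that [D'] puts on [A] is counted twice in the sum of absolute differences: as a deficit
    of [D] on [A], and as an excess of [D] off [A]. The factor 1/2 compensates. *)
Lemma TV_ge_void (R : realType) (n : nat) (D D' : dist R n) (A : {pred 'I_n}) :
  (forall i, i \in A -> D i = 0) -> \sum_(i in A) D' i <= TV D D'.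
Proof.
move=> D0; rewrite /TV.
have sumA (E : dist R n) : \sum_(i in A) E i + \sum_(i | i \notin A) E i = 1.
  by rewrite -(mass_sum1 E) [RHS](bigID (mem A)).
have DA : \sum_(i in A) D i = 0 by exact: big1.
have geA : \sum_(i in A) D' i <= \sum_(i in A) `|D i - D' i|.
  by apply: ler_sum => i Ai; rewrite D0 // sub0r normrN ler_norm.
have geN : \sum_(i | i \notin A) D i - \sum_(i | i \notin A) D' i <=
    \sum_(i | i \notin A) `|D i - D' i|.
  by rewrite -sumrB; apply: ler_sum => i _; exact: ler_norm.
have := sumA D; have := sumA D'.
by rewrite [X in 2^-1 * X](bigID (mem A)) /=; lra.
Qed.

(** Some point has mass at least [1/n]; there the absolute value opens exactly, and the triangle
    inequality at all other points gives the bound. *)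
Lemma TV_unif_le (R : realType) (n : nat) (n_gt0 : (0 < n)%N) (D : dist R n) :
  TV D (unif R n_gt0) <= 1 - n%:R^-1.
Proof.
have [i0 Di0] : exists i0, n%:R^-1 <= D i0.
  apply/existsP; apply: contraT; rewrite negb_exists => /forallP Dlt.
  have : \sum_(i < n) D i < \sum_(i < n) n%:R^-1.
    apply: ltr_sum => [|i _]; last by rewrite ltNge.
    by apply/hasP; exists (Ordinal n_gt0); rewrite ?mem_index_enum.
  by rewrite mass_sum1 uniform_mass_sum1 // ltxx.
have sumD := mass_sum1 D; have sumU := uniform_mass_sum1 R n_gt0.
rewrite (bigD1 i0) //= in sumD; rewrite (bigD1 i0) //= in sumU.
rewrite /TV (bigD1 i0) //= ger0_norm ?subr_ge0 //.
have : \sum_(i < n | i != i0) `|D i - n%:R^-1| <=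
    \sum_(i < n | i != i0) D i + \sum_(i < n | i != i0) n%:R^-1.
  rewrite -big_split; apply: ler_sum => i _.
  apply: le_trans (ler_normB _ _) _.
  by rewrite !ger0_norm ?mass_ge0 ?uniform_mass_ge0.
by lra.
Qed.

(** * Random block representatives and their inner products *)

Section BlockMixture.
Context {R : realType} {n : nat} {J : finType} (p : 'I_n -> J).

Definition block_size (j : J) : nat := #|[pred i | p i == j]|.

Definition sections : {pred {ffun J -> 'I_n}} := family (fun j => [pred i | p i == j]).

Implicit Types r : {ffun J -> 'I_n}.

(** The law [D_r] when [r] picks a point in every block; [r (p i) == i] tests whether [i] is the
    chosen point of its own block. *)
Definition section_mass (r : {ffun J -> 'I_n}) (i : 'I_n) : R :=
  if r (p i) == i then (block_size (p i))%:R / n%:R else 0.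

Lemma sectionsP (r : {ffun J -> 'I_n}) : reflect (forall j, p (r j) = j) (r \in sections).
Proof.
apply: (iffP familyP) => pr j; first by have := pr j; rewrite inE => /eqP.
by rewrite inE pr.
Qed.

Lemma sum_section_mass r (F : 'I_n -> R) : r \in sections ->
  \sum_i section_mass r i * F i = \sum_j (block_size j)%:R / n%:R * F (r j).
Proof.
move=> /sectionsP pr; rewrite (partition_big p xpredT) //=.
apply: eq_bigr => j _; rewrite (bigD1 (r j)) /=; last by rewrite pr.
rewrite /section_mass pr eqxx big1 ?addr0 // => i /andP[/eqP <- /negbTE ne].
by rewrite eq_sym ne mul0r.
Qed.

Lemma sum_block_size : \sum_j (block_size j)%:R = n%:R :> R.
Proof.
rewrite -natr_sum -[in RHS](card_ord n) -sum1_card (partition_big p xpredT) //=.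
by congr (_%:R); apply: eq_bigr => j _; rewrite sum1_card.
Qed.

Lemma section_mass_ge0 r i : 0 <= section_mass r i.
Proof. by rewrite /section_mass; case: ifP => // _; rewrite divr_ge0 ?ler0n. Qed.

Lemma section_mass_sum1 r : (0 < n)%N -> r \in sections ->
  \sum_i section_mass r i = 1.
Proof.
move=> n_gt0 pr; under eq_bigr do rewrite -[section_mass _ _]mulr1.
rewrite (sum_section_mass (fun=> 1)) //.
under eq_bigr do rewrite mulr1.
by rewrite -mulr_suml sum_block_size mulfV // pnatr_eq0 -lt0n.
Qed.

Lemma inner_section_mass r r' : r \in sections -> r' \in sections ->
  n%:R * \sum_i section_mass r i * section_mass r' i =
  n%:R^-1 * \sum_j (block_size j)%:R ^+ 2 * (r j == r' j)%:R.
Proof.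
move=> pr pr'; rewrite sum_section_mass //.
have [n0|n0] := eqVneq (n%:R : R) 0; first by rewrite n0 invr0 !mul0r.
rewrite !mulr_sumr; apply: eq_bigr => j _.
rewrite /section_mass (sectionsP _ pr) eq_sym.
by case: eqP => _; rewrite /= ?mulr1n ?mulr1 ?mulr0 //; field.
Qed.

(** Unnormalized independence of the choices made in different blocks by a uniform section. *)
Lemma sum_sections_prod (F : J -> 'I_n -> R) :
  \sum_(r in sections) \prod_j F j (r j) = \prod_j \sum_(i | p i == j) F j i.
Proof. by rewrite bigA_distr_big_dep. Qed.

Lemma card_sections : #|sections|%:R = \prod_j (block_size j)%:R :> R.
Proof.
rewrite -sum1_card natr_sum.
transitivity (\sum_(r in sections) \prod_(j : J) (1 : R)).
  by apply: eq_bigr => r _; rewrite big1.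
rewrite (sum_sections_prod (fun _ _ => 1)); apply: eq_bigr => j _.
by rewrite sumr_const.
Qed.

Context (G : nat) (block_le : forall j, (block_size j <= G)%N).

(** Each term is at most [G] times the block size, and the block sizes add up to [n]. *)
Lemma inner_section_mass_le r r' : r \in sections -> r' \in sections ->
  n%:R * \sum_i section_mass r i * section_mass r' i <= G%:R.
Proof.
move=> pr pr'; rewrite inner_section_mass //.
have [n0|n0] := eqVneq (n%:R : R) 0; first by rewrite n0 invr0 mul0r ler0n.
have n_gt0 : 0 < (n%:R : R) by rewrite lt_def n0 ler0n.
rewrite ler_pdivrMl // -sum_block_size mulr_suml ler_sum // => j _.
have sz0 : 0 <= (block_size j)%:R :> R by rewrite ler0n.
have szG : (block_size j)%:R <= G%:R :> R by rewrite ler_nat.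
by case: eqP => _; rewrite ?mulr1 ?mulr0; nra.
Qed.

(* Each factor is the exponential moment of a centred variable bounded by
   [s * G ^ 2]. *)
Lemma sum_expR_block_le (s : R) (j : J) (i' : 'I_n) : 0 <= s -> p i' = j ->
  \sum_(i | p i == j)
    expR (s * ((block_size j)%:R ^+ 2 * (i' == i)%:R - (block_size j)%:R)) <=
  (block_size j)%:R * expR (3 * (s * G%:R ^+ 2) ^+ 2).
Proof.
move=> s_ge0 pi'; set g : R := (block_size j)%:R.
pose y i := s * (g ^+ 2 * (i' == i)%:R - g).
have g_ge0 : 0 <= g by rewrite ler0n.
have gG : g <= G%:R by rewrite ler_nat.
(* Integrality of the block size is used to bound [g] by [G ^ 2] when the indicator vanishes. *)
have g1 : g = 0 \/ 1 <= g.
  by rewrite /g; case: (block_size j) => [|k]; [left | right; rewrite ler1n].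
have sumy : \sum_(i | p i == j) y i = 0.
  rewrite -mulr_sumr sumrB -mulr_sumr (bigD1 i') /= ?pi' // eqxx big1; last first.
    by move=> i /andP[_ /negbTE]; rewrite eq_sym => ->.
  by rewrite sumr_const -/(block_size j) -[g *+ _]mulr_natr -/g mulr1n; ring.
have sqry i : y i ^+ 2 <= (s * G%:R ^+ 2) ^+ 2.
  rewrite /y !exprMn ler_wpM2l ?exprn_ge0 //.
  set z := _ - g; have [zG Gz] : z <= G%:R ^+ 2 /\ - z <= G%:R ^+ 2.
    by rewrite /z; case: eqP => _; rewrite ?mulr1 ?mulr0; case: g1 => [g0|g1]; split; nra.
  rewrite -subr_ge0 subr_sqr; apply: mulr_ge0; [by rewrite subr_ge0|].
  by rewrite -lerBlDr sub0r.
(* The linear terms [y i] cancel by [sumy], which leaves only the quadratic exponent. *)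
apply: (@le_trans _ _ (\sum_(i | p i == j) (y i + expR (3 * (s * G%:R ^+ 2) ^+ 2)))).
  apply: ler_sum => i _; apply: le_trans (expR_le_add_expR_sqr _) _.
  by rewrite lerD2l ler_expR; apply: ler_wpM2l (sqry i).
by rewrite big_split /= sumy add0r sumr_const -/(block_size j)
  -[_ *+ block_size j]mulr_natl.
Qed.

Lemma sum_inner_pow_le (m : nat) : (0 < n)%N -> (#|J| <= n)%N ->
  \sum_(r in sections) \sum_(r' in sections)
    (n%:R * \sum_i section_mass r i * section_mass r' i) ^+ m <=
  #|sections|%:R ^+ 2 * expR (3 * G%:R ^+ 4 * m%:R ^+ 2 / n%:R).
Proof.
move=> n_gt0 Jn; have n_gt0R : 0 < (n%:R : R) by rewrite ltr0n.
set s : R := m%:R / n%:R.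
have s_ge0 : 0 <= s by rewrite divr_ge0 ?ler0n.
rewrite expr2 -mulrA mulr_natl -sumr_const; apply: ler_sum => r pr.
(* For fixed [r] and inner product [x], [x ^+ m <= expR (m (x - 1))]. Since the block sizes sum to
   [n], this exponential is the product over [j] of [phi j (r' j)]. *)
pose phi j i := expR (s * ((block_size j)%:R ^+ 2 * (r j == i)%:R - (block_size j)%:R)).
apply: (@le_trans _ _ (\sum_(r' in sections) \prod_j phi j (r' j))).
  apply: ler_sum => r' pr'; rewrite -expR_sum.
  have x_ge0 : 0 <= n%:R * \sum_i section_mass r i * section_mass r' i.
    by rewrite mulr_ge0 ?ler0n ?sumr_ge0 // => i _; rewrite mulr_ge0 ?section_mass_ge0.
  rewrite -mulr_sumr sumrB sum_block_size.
  move: x_ge0 (expR_ge1Dx (n%:R * (\sum_i section_mass r i * section_mass r' i) - 1)).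
  rewrite inner_section_mass //; set x := n%:R^-1 * _ => x_ge0 x_le.
  rewrite [X in expR X](_ : _ = m%:R * (x - 1)); last first.
    by rewrite /s /x; field; rewrite gt_eqF.
  by rewrite expRM_natl lerXn2r ?nnegrE ?expR_ge0 //; apply: le_trans x_le; lra.
rewrite sum_sections_prod.
apply: (@le_trans _ _ (\prod_j ((block_size j)%:R * expR (3 * (s * G%:R ^+ 2) ^+ 2)))).
  apply: ler_prod => j _; rewrite sumr_ge0 /= => [|i _]; last exact: expR_ge0.
  exact/sum_expR_block_le/sectionsP.
rewrite big_split /= -card_sections ler_wpM2l ?ler0n //.
(* Replacing [#|J|] by [n] in the exponent cancels one of the two powers of [n] in the denominator
   of [s ^+ 2]. *)
rewrite prodr_const -expRM_natl ler_expR.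
rewrite [leRHS](_ : _ = n%:R * (3 * (s * G%:R ^+ 2) ^+ 2)); last first.
  by rewrite /s; field; rewrite gt_eqF.
by rewrite ler_wpM2r ?ler_nat // mulr_ge0 ?sqr_ge0.
Qed.
End BlockMixture.

(** * The second-moment inequality for mixtures *)

Lemma sum_tuple_prod (R : comPzSemiRingType) (n m : nat) (F : 'I_n -> R) :
  \sum_(v : m.-tuple 'I_n) \prod_(s < m) F (tnth v s) = (\sum_i F i) ^+ m.
Proof.
rewrite -[m in RHS]card_ord -prodr_const (bigA_distr_bigA (fun _ => F)).
rewrite (reindex (fun f : {ffun 'I_m -> 'I_n} => [tuple f s | s < m])).
  by apply: eq_bigr => f _; apply: eq_bigr => s _; rewrite tnth_mktuple.
exists (fun v : m.-tuple 'I_n => [ffun s => tnth v s]) => [f _|v _].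
  by apply/ffunP => s; rewrite ffunE tnth_mktuple.
by apply: eq_from_tnth => s; rewrite tnth_mktuple ffunE.
Qed.

(** Cauchy-Schwarz on the words in [B], applied to the unnormalized mixture likelihood [W]. The
    uniform bound limits the number of such words, and the sum of [W ^+ 2] factorizes over
    coordinates for each pair of parameters. *)
Lemma mixture_second_moment (R : realFieldType) (n m : nat) (X : finType)
    (A : {pred X}) (D : X -> 'I_n -> R) (B : pred (seq 'I_n)) (alpha delta : R) :
  (0 < n)%N -> 0 <= alpha -> (forall x i, 0 <= D x i) ->
  (forall x, x \in A ->
    alpha <= \sum_(v : m.-tuple 'I_n | B v) \prod_(s < m) D x (tnth v s)) ->
  \sum_(v : m.-tuple 'I_n | B v) \prod_(s < m) n%:R^-1 <= delta ->
  alpha ^+ 2 * #|A|%:R ^+ 2 <=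
  delta * \sum_(x in A) \sum_(y in A) (n%:R * \sum_i D x i * D y i) ^+ m.
Proof.
move=> n_gt0 alpha_ge0 D_ge0 alpha_le B_le.
have n_neq0 : (n%:R : R) != 0 by rewrite pnatr_eq0 -lt0n.
pose W := fun v : m.-tuple 'I_n => \sum_(x in A) \prod_(s < m) D x (tnth v s).
pose Bv := [pred v : m.-tuple 'I_n | B v].
have AW : alpha * #|A|%:R <= \sum_(v in Bv) W v.
  rewrite /W exchange_big /= mulr_natr -sumr_const.
  by apply: ler_sum => x Ax; exact: alpha_le.
have cardB : #|Bv|%:R <= delta * n%:R ^+ m.
  rewrite -ler_pdivrMr ?exprn_gt0 ?ltr0n //; apply: le_trans B_le.
  under eq_bigr do rewrite prodr_const card_ord.
  by rewrite sumr_const exprVn mulr_natl.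
have W2 : \sum_v W v ^+ 2 =
    \sum_(x in A) \sum_(y in A) (\sum_i D x i * D y i) ^+ m.
  under eq_bigr do rewrite expr2 mulr_suml.
  rewrite exchange_big; apply: eq_bigr => x _ /=.
  under eq_bigr do rewrite mulr_sumr.
  rewrite exchange_big; apply: eq_bigr => y _ /=.
  by rewrite -sum_tuple_prod; apply: eq_bigr => v _; rewrite -big_split.
rewrite -exprMn; apply: (@le_trans _ _ ((\sum_(v in Bv) W v) ^+ 2)).
  by rewrite lerXn2r ?nnegrE ?mulr_ge0 ?ler0n // (le_trans _ AW) ?mulr_ge0 ?ler0n.
apply: le_trans (sqr_sum_le_card _ _) _.
apply: (@le_trans _ _ (#|Bv|%:R * \sum_v W v ^+ 2)).
  apply: ler_wpM2l; first exact: ler0n.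
  by rewrite [leRHS](bigID Bv) /= lerDl sumr_ge0 // => v _; exact: sqr_ge0.
have W2_ge0 : 0 <= \sum_v W v ^+ 2 by rewrite sumr_ge0 // => v _; exact: sqr_ge0.
apply: le_trans (ler_wpM2r W2_ge0 cardB) _.
rewrite -mulrA W2 mulr_sumr; under [in leLHS]eq_bigr do rewrite mulr_sumr.
by under [in leRHS]eq_bigr do under eq_bigr do rewrite exprMn.
Qed.

(** For [delta < 1/3], [(1 - delta) ^+ 2] exceeds 4/9, hence 1/3; this accounts for the factor 3 in
    the logarithm. *)
Lemma ln_inv3_le (R : realType) (delta y : R) : 0 < delta -> delta < 1 / 3 ->
  (1 - delta) ^+ 2 <= delta * expR y -> ln (1 / (3 * delta)) <= y.
Proof.
move=> d0 d3 le_y; rewrite -ler_expR lnK ?posrE ?divr_gt0 ?mulr_gt0 //.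
by rewrite ler_pdivrMr ?mulr_gt0 //; nra.
Qed.

(** * Consequences of correctness and of the time budget *)

Lemma Prob_gt0_ex (R : realType) (n : nat) (D : dist R n) (S : iid_sample D)
    (E : (nat -> 'I_n) -> Prop) : (0 < Prob S E)%E -> exists x, E x.
Proof.
rewrite /Prob => P_gt0.
have [[w Ew]|no] := pselect (exists w, E (fun t => obs S t w)).
  by exists (fun t => obs S t w).
move: P_gt0; rewrite (_ : [set w | _]%classic = set0) ?measure0 ?ltxx //.
by apply/seteqP; split => // w Ew; case: no; exists w.
Qed.

Section LowerBound.
Context {R : realType} {n : nat} (n_gt0 : (0 < n)%N).
Context (S : forall D : dist R n, iid_sample D) (eps delta : R).
Context (T : stopping_rule n) (b : R).
Hypotheses (delta_lt1 : delta < 1) (T_correct : delta_correct n_gt0 S eps delta T).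
Hypothesis (T_stops : stops_within n_gt0 S eps delta T b).

(** With [b <= 0] both time limits allow only time 0. Both events have positive probability, so the
    empty word would carry verdicts 1 and 2. *)
Lemma budget_gt0 : (exists D : dist R n, eps < TV D (unif R n_gt0)) -> 0 < b.
Proof.
case=> D epsD; rewrite ltNge; apply/negP => b_le0.
have zero (x : nat -> 'I_n) j (c : R) : (j != 0)%N ->
    (tau R T j x <= (b / c ^+ 2)%:E)%E -> T [::] = j :> nat.
  move=> j0; rewrite tau_leP // => /andP[bc /eqP <-].
  suff -> : b / c ^+ 2 = 0 by rewrite truncn0.
  by apply/eqP; rewrite eq_le bc andbT mulr_le0_ge0 // invr_ge0 sqr_ge0.
have delta_pos : (0 < (1 - delta)%:E)%E by rewrite lte_fin subr_gt0.
have [x /zero T2] := Prob_gt0_ex (lt_le_trans delta_pos (T_stops.1 D epsD)).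
have [y /zero T1] := Prob_gt0_ex (lt_le_trans delta_pos T_stops.2).
by have := T2 isT; rewrite (T1 isT).
Qed.

(** By stability, verdict 2 at time [m] excludes verdict 1 at every time, so the event lies inside
    the error event under the uniform law. *)
Lemma unif_word_le m :
  \sum_(v : m.-tuple 'I_n | T v == 2%N :> nat) \prod_(s < m) n%:R^-1 <= delta.
Proof.
rewrite -lee_fin.
rewrite -(Prob_word (S (unif R n_gt0)) m (fun v => T v == 2%N :> nat)).
apply: le_trans T_correct.1; apply: le_measure.
- by rewrite inE; exact: (measurable_word _ m (fun v => T v == 2%N :> nat)).
- rewrite inE (_ : [set w | _]%classic = (\bigcap_t
      [set w | (T (mkseq (fun t => obs (S (unif R n_gt0)) t w) t) != 1%N :> nat)])%classic).
    apply: bigcap_measurableType => t _.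
    exact: (measurable_word _ t (fun v => T v != 1%N :> nat)).
  apply/seteqP; split => w /=; rewrite tau21P => H t.
    by move=> _; apply/eqP.
  by apply/eqP/H.
move=> w /= /eqP T2; apply/tau21P => t T1.
have := verdict_mono (j := 2) (leq_maxl m t) isT T2.
by rewrite (verdict_mono (j := 1) (leq_maxr m t) isT T1).
Qed.

(** Leaving [m] free above the individual limit lets one [m] serve all members of a mixture. *)
Lemma alternative_word_ge (D : dist R n) m :
  eps < TV D (unif R n_gt0) -> (Num.truncn (b / TV D (unif R n_gt0) ^+ 2) <= m)%N ->
  1 - delta <= \sum_(v : m.-tuple 'I_n | T v == 2%N :> nat) \prod_(s < m) D (tnth v s).
Proof.
move=> epsD bm; set c := b / _ in bm.
rewrite -lee_fin -(Prob_word (S D) m (fun v => T v == 2%N :> nat)).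
apply: le_trans (T_stops.1 D epsD) _; rewrite -/c.
pose B := fun v : seq 'I_n => (0 <= c) && (T v == 2%N :> nat).
rewrite [leLHS](_ : _ = Prob (S D) (fun x => B (mkseq x (Num.truncn c)))); last first.
  congr (sample_prob _ _); apply/funext => w /=; apply/propext.
  by rewrite tau_leP.
apply: le_measure.
- by rewrite inE; exact: measurable_word.
- by rewrite inE; exact: (measurable_word _ m (fun v => T v == 2%N :> nat)).
move=> w /= /andP[c_ge0 /eqP T2]; apply/eqP; by apply: verdict_mono T2.
Qed.
End LowerBound.

(** * Sample-size bounds from a block mixture *)

Lemma TV_section_ge (R : realType) (n : nat) (n_gt0 : (0 < n)%N) (J : finType)
    (p : 'I_n -> J) (r : {ffun J -> 'I_n}) (pr : r \in sections p) :
  1 - #|J|%:R / n%:R <=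
  TV (Dist (section_mass_ge0 p r) (section_mass_sum1 n_gt0 pr)) (unif R n_gt0).
Proof.
have n_neq0 : (n%:R : R) != 0 by rewrite pnatr_eq0 -lt0n.
pose A := [pred i | r (p i) != i].
apply: le_trans (TV_ge_void (A := A) _ _) => [|i]; last first.
  by rewrite inE /= /section_mass => /negbTE ->.
rewrite sumr_const -[leRHS]mulr_natl -[X in X - _](mulfV n_neq0) -mulrBl.
rewrite ler_wpM2r ?invr_ge0 ?ler0n // lerBlDr -natrD ler_nat.
rewrite -[leqLHS]card_ord -(cardC A) leq_add2l.
(* The points outside [A] are values of [r], so there are at most [#|J|] of them. *)
apply: leq_trans (leq_image_card r predT).
apply: subset_leq_card; apply/fintype.subsetP => i.
by move=> /negPn/eqP <-; exact: fintype.image_f.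
Qed.

Lemma sample_lower_bounds (R : realType) (n : nat) (n_gt0 : (0 < n)%N)
    (S : forall D : dist R n, iid_sample D) (eps delta : R) (T : stopping_rule n)
    (b : R) (J : finType) (p : 'I_n -> J) (r0 : J -> 'I_n) (G : nat) :
  cancel r0 p -> (forall j, (block_size p j <= G)%N) ->
  eps < 1 - #|J|%:R / n%:R -> 2^-1 <= 1 - #|J|%:R / n%:R :> R ->
  0 < b -> 0 < delta -> delta < 1 / 3 ->
  delta_correct n_gt0 S eps delta T -> stops_within n_gt0 S eps delta T b ->
  ln (1 / (3 * delta)) <= 4 * G%:R * b /\
  n%:R * ln (1 / (3 * delta)) <= 48 * G%:R ^+ 4 * b ^+ 2.
Proof.
move=> r0K block_le epsJ halfJ b_gt0 d_gt0 d_lt3 T_correct T_stops.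
have n_gt0R : 0 < (n%:R : R) by rewrite ltr0n.
have d_lt1 : delta < 1 by lra.
(* Every [D_r] is at distance at least 1/2 from uniform, so its time limit is at most [4 * b]. *)
pose m := Num.truncn (4 * b).
have m_le : m%:R <= 4 * b by rewrite truncn_le; lra.
pose Q := \sum_(r in sections p) \sum_(r' in sections p)
  (n%:R * \sum_i section_mass p r i * section_mass p r' i : R) ^+ m.
have N_gt0 : 0 < (#|sections p|%:R : R).
  rewrite ltr0n; apply/card_gt0P; exists (finfun r0); apply/sectionsP => j.
  by rewrite ffunE r0K.
have Q_ge : (1 - delta) ^+ 2 * #|sections p|%:R ^+ 2 <= delta * Q.
  apply: (mixture_second_moment (B := fun v => T v == 2%N :> nat)) => //.
  - by rewrite subr_ge0 ltW.
  - by move=> r i; exact: section_mass_ge0.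
  - move=> r pr; have TV_ge := TV_section_ge R n_gt0 pr.
    apply: (alternative_word_ge T_stops (lt_le_trans epsJ TV_ge)).
    have := le_trans halfJ TV_ge; set tv := TV _ _ => tv_ge.
    have tv_gt0 : 0 < tv by lra.
    apply: le_truncn; rewrite ler_pdivrMr ?exprn_gt0 //.
    have : 1 <= 4 * tv ^+ 2 by nra.
    by nra.
  - exact: unif_word_le T_correct m.
have {Q_ge} log_le y : Q <= #|sections p|%:R ^+ 2 * expR y -> ln (1 / (3 * delta)) <= y.
  move=> Qy; apply: ln_inv3_le => //.
  have N2_gt0 : 0 < (#|sections p|%:R : R) ^+ 2 by rewrite exprn_gt0.
  rewrite -(ler_pM2r N2_gt0); apply: le_trans Q_ge _.
  by rewrite -mulrA ler_pM2l // mulrC.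
split.
  (* Each inner product is at most [G <= expR G], so [Q] is at most [#|sections p| ^ 2] times
     [expR (m G)]. *)
  apply: (@le_trans _ _ (m%:R * G%:R)).
    apply: log_le; rewrite expr2 -mulrA mulr_natl -sumr_const.
    apply: ler_sum => r pr; rewrite mulr_natl -sumr_const.
    apply: ler_sum => r' pr'; rewrite expRM_natl lerXn2r ?nnegrE ?expR_ge0 //.
      rewrite mulr_ge0 ?ler0n ?sumr_ge0 // => i _.
      by rewrite mulr_ge0 ?section_mass_ge0.
    apply: le_trans (inner_section_mass_le block_le pr pr') _.
    by apply: le_trans (expR_ge1Dx _); rewrite lerDr.
  by rewrite [leRHS]mulrAC ler_wpM2r // ler0n.
have Jn : (#|J| <= n)%N.
  have : #|J|%:R / n%:R <= 1 :> R by lra.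
  by rewrite ler_pdivrMr // mul1r ler_nat.
have := log_le _ (sum_inner_pow_le block_le m n_gt0 Jn).
rewrite ler_pdivlMr // mulrC => /le_trans; apply.
have -> : 48 * G%:R ^+ 4 * b ^+ 2 = 3 * G%:R ^+ 4 * (4 * b) ^+ 2 :> R by ring.
rewrite ler_wpM2l ?mulr_ge0 ?exprn_ge0 ?ler0n //.
by rewrite lerXn2r ?nnegrE ?ler0n // mulr_ge0 // ltW.
Qed.

(** * Residue classes as blocks of bounded size *)

Lemma card_residue_class (n k j : nat) :
  (0 < k)%N -> (#|[pred i : 'I_n | i %% k == j]| <= (n %/ k).+1)%N.
Proof.
move=> k_gt0; rewrite -[leqRHS]card_ord.
pose f (i : 'I_n) : 'I_(n %/ k).+1 := inord (i %/ k).
rewrite -(@card_in_image _ _ f); first exact: max_card.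
move=> i i' /eqP ij /eqP i'j /(congr1 (@nat_of_ord _)); rewrite /f.
rewrite !inordK ?ltnS ?leq_div2r ?(ltnW (ltn_ord _)) // => eq_div.
by apply: val_inj; rewrite /= (divn_eq i k) (divn_eq i' k) eq_div ij i'j.
Qed.

Lemma exists_blocks (R : realType) (eps0 : R) : eps0 < 1 ->
  exists2 G : nat, (0 < G)%N & forall (n : nat) (eps : R), (2 <= n)%N ->
    eps <= eps0 -> eps < 1 - n%:R^-1 ->
    exists k (p : 'I_n -> 'I_k) (r0 : 'I_k -> 'I_n),
      [/\ cancel r0 p, forall j, (block_size p j <= G)%N,
          eps < 1 - k%:R / n%:R & 2^-1 <= 1 - k%:R / n%:R :> R].
Proof.
move=> eps0_lt1.
(* [g > 2 / (1 - eps0)] keeps [k / n] below [1 - eps0] when [k = n %/ g], and [g >= 2] gives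
   [k <= n / 2] in that case. *)
pose g := (Num.truncn (2 / (1 - eps0))).+2.
exists g.*2 => // n eps n_ge2 eps_le eps_lt.
have n_gt0 : (0 < n)%N by exact: ltnW.
have n_gt0R : 0 < (n%:R : R) by rewrite ltr0n.
pose k := maxn 1 (n %/ g).
have k_gt0 : (0 < k)%N by rewrite leq_max.
have k_le2 : (k * 2 <= n)%N.
  rewrite /k; case: (leqP (n %/ g) 1) => _; first by rewrite mul1n.
  by apply: leq_trans (leq_trunc_div n g); rewrite leq_mul2l orbT.
have k_le : (k <= n)%N by lia.
pose p (i : 'I_n) : 'I_k := Ordinal (ltn_pmod i k_gt0).
exists k, p, (widen_ord k_le); split.
- by move=> j; apply: val_inj; rewrite /= modn_small.
- move=> j; apply: leq_trans (_ : ((n %/ k).+1 <= _)%N).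
    apply: leq_trans (card_residue_class n j k_gt0).
    by apply: subset_leq_card; apply/fintype.subsetP => i; rewrite !inE => /eqP <-.
  rewrite ltn_divLR // /k.
  (* If [n %/ g <= 1], then [k = 1] and [n < 2 g]; otherwise [n < (k + 1) g <= 2 k g]. *)
  have := divn_eq n g; have := ltn_pmod n (isT : (0 < g)%N).
  by case: (leqP (n %/ g) 1) => ?; nia.
- rewrite /k; case: (leqP (n %/ g) 1) => [_|gt1]; first by rewrite mul1r.
  apply: (le_lt_trans eps_le); rewrite ltrBrDl -ltrBrDr ltr_pdivrMr //.
  have g_gt : 2 / (1 - eps0) < g%:R.
    by apply: lt_trans (truncnS_gt _) _; rewrite ltr_nat.
  rewrite ltr_pdivrMr in g_gt; last by lra.
  have : (n %/ g)%:R * g%:R <= n%:R :> R by rewrite -natrM ler_nat leq_trunc_div.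
  have : 0 < (n %/ g)%:R :> R by rewrite ltr0n ltnW.
  set q := (n %/ g)%:R; set h := g%:R in g_gt *.
  by nra.
have : k%:R / n%:R <= 2^-1 :> R.
  by rewrite ler_pdivrMr // -ler_pdivrMl ?invr_gt0 // invrK mulrC -natrM ler_nat.
by lra.
Qed.

Theorem theorem5 (R : realType) (eps0 : R) (eps0_lt1 : eps0 < 1) :
  exists c : R, 0 < c /\
    forall (n : nat) (n_ge2 : (2 <= n)%N)
           (S : forall D : dist R n, iid_sample D) (eps delta : R),
      0 < eps -> eps <= eps0 ->
      (exists D : dist R n, eps < TV D (unif R (ltnW n_ge2))) ->
      0 < delta -> delta < 1 ->
      ~ (exists T : stopping_rule n,
           delta_correct (ltnW n_ge2) S eps delta T /\
           stops_within (ltnW n_ge2) S eps delta T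
             (c * Num.sqrt (n%:R * ln (1 / (3 * delta))))) /\
      ~ (exists T : stopping_rule n,
           delta_correct (ltnW n_ge2) S eps delta T /\
           stops_within (ltnW n_ge2) S eps delta T
             (c * ln (1 / (3 * delta)))).
Proof.
have [G G_gt0 blocks] := exists_blocks eps0_lt1.
have G_gt0R : 0 < (G%:R : R) by rewrite ltr0n.
(* This makes [48 G^4 c^2 = 3/16] and [4 G c = 1/(4 G)], both below 1, so each lower bound
   contradicts its own budget. *)
pose c : R := (16 * G%:R ^+ 2)^-1.
have c_gt0 : 0 < c by rewrite invr_gt0 mulr_gt0 ?exprn_gt0.
exists c; split=> // n n_ge2 S eps delta _ eps_le [D epsD] d_gt0 d_lt1.
have n_gt0R : 0 < (n%:R : R) by rewrite ltr0n ltnW.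
have [k [p [r0 [r0K block_le epsk halfk]]]] :=
  blocks n eps n_ge2 eps_le (lt_le_trans epsD (TV_unif_le _ D)).
set L := ln (1 / (3 * delta)).
have delta_lt3 : 0 < L -> delta < 1 / 3.
  move=> L_gt0; rewrite ltNge; apply/negP => d_ge.
  suff : L <= 0 by rewrite leNgt L_gt0.
  by apply: ln_le0; rewrite ler_pdivrMr ?mulr_gt0 //; lra.
(* Either budget is positive only if [L] is, so [budget_gt0] also disposes of the case
   [delta >= 1/3]. *)
have bounds T b : delta_correct (ltnW n_ge2) S eps delta T ->
    stops_within (ltnW n_ge2) S eps delta T b -> (0 < b -> 0 < L) ->
    [/\ 0 < L, L <= 4 * G%:R * b & n%:R * L <= 48 * G%:R ^+ 4 * b ^+ 2].
  move=> T_correct T_stops bL.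
  have b_gt0 := budget_gt0 d_lt1 T_stops (ex_intro _ D epsD).
  have d_lt3 := delta_lt3 (bL b_gt0).
  have [||] :=
    sample_lower_bounds r0K block_le _ _ b_gt0 d_gt0 d_lt3 T_correct T_stops.
  - by rewrite card_ord.
  - by rewrite card_ord.
  by split=> //; exact: bL.
split=> -[T [T_correct T_stops]].
  have [|L0 _ +] := bounds T _ T_correct T_stops.
    by rewrite pmulr_rgt0 // sqrtr_gt0 pmulr_rgt0.
  have nL_gt0 : 0 < n%:R * L by rewrite mulr_gt0.
  rewrite exprMn (sqr_sqrtr (ltW nL_gt0)).
  have -> : 48 * G%:R ^+ 4 * (c ^+ 2 * (n%:R * L)) = 3 / 16 * (n%:R * L).
    by rewrite /c; field; rewrite gt_eqF.
  by lra.
have [|L0 + _] := bounds T _ T_correct T_stops; first by rewrite pmulr_rgt0.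
have -> : 4 * G%:R * (c * L) = (4 * G%:R)^-1 * L.
  by rewrite /c; field; rewrite gt_eqF.
rewrite leNgt => /negP; apply; rewrite -ltr_pdivlMr // mulfV ?gt_eqF //.
rewrite invf_lt1 ?mulr_gt0 //.
have : 1 <= G%:R :> R by rewrite ler1n.
by lra.
Qed.
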